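(* Let $R$ be a nonzero finite ring. The diameter of the Farey complex $\mathscr{E}_R$ satisfies $$\operatorname{diam}\mathscr{E}_R=\begin{cases}1&\text{if }R\text{ is }\mathbb{Z}/2\mathbb{Z},\\ 2&\text{if }R\text{ is }\mathbb{Z}/3\mathbb{Z},\ \mathbb{Z}/4\mathbb{Z},\text{ or }(\mathbb{Z}/2\mathbb{Z})^n\text{ for some }n>1,\\ 3&\text{otherwise,}\end{cases}$$ where ''$R$ is'' means up to ring isomorphism.
   Context: All rings are commutative with identity $1$. A pair $(a,b)\in R\times R$ is unimodular if $aR+bR=R$. $\mathscr{E}_R$ is the directed graph whose vertices are the unimodular pairs in $R\times R$, with a directed edge $(a,b)\to(c,d)$ if and only if $ad-bc=1$. The diameter of $\mathscr{E}_R$ is the maximum, over all pairs of vertices $u,v$, of the length (number of edges) of a shortest directed path from $u$ to $v$. $(\mathbb{Z}/2\mathbb{Z})^n$ denotes the direct product of $n$ copies of the ring $\mathbb{Z}/2\mathbb{Z}$. *)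

(* Defs.v *)
From HB Require Import structures.
From mathcomp Require Import all_boot all_algebra.

Set Implicit Arguments.
Unset Strict Implicit.
Unset Printing Implicit Defensive.

Import GRing.Theory.
Local Open Scope ring_scope.

Section DirectedGraph.
Variables (T : Type) (e : rel T).

Definition has_dpath (k : nat) (u v : T) : Prop :=
  exists p : seq T, [/\ path e u p, last u p = v & size p = k].

Definition is_dist (u v : T) (k : nat) : Prop :=
  has_dpath k u v /\ forall j : nat, has_dpath j u v -> (k <= j)%N.

(* The distance between any two vertices is required to exist, so this fails
   for every d when the graph is not strongly connected. *)
Definition is_diam (d : nat) : Prop :=
  (forall u v : T, exists2 k : nat, is_dist u v k & (k <= d)%N) /\
  (exists u v : T, is_dist u v d).

End DirectedGraph.

Section Farey.
Variable R : finComNzRingType.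

Definition unimodular (u : R * R) : bool :=
  [forall r : R, exists x : R, exists y : R, u.1 * x + u.2 * y == r].

Definition farey_vertex := {u : R * R | unimodular u}.

Definition farey_edge : rel farey_vertex := fun u v =>
  (val u).1 * (val v).2 - (val u).2 * (val v).1 == 1.

End Farey.

Definition ring_isomorphic (R S : pzRingType) : Prop :=
  exists f : {rmorphism R -> S}, bijective f.

(* Main.v *)
Require Import Defs.
From HB Require Import structures.
From mathcomp Require Import all_boot all_algebra.
From mathcomp Require Import ring.

Set Implicit Arguments.
Unset Strict Implicit.
Unset Printing Implicit Defensive.

Import GRing.Theory.

(** Write det p q for p.1 q.2 - p.2 q.1, so that an edge p -> q means
    det p q = 1. A vertex u has some neighbour w, and since det u w = 1 the pair
    u, w is a basis of R x R in which any vertex v has a unimodular coordinate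
    pair (alpha, beta), with alpha = det v w and beta = det u v. Every question
    about walks from u to v becomes a question about (alpha, beta).

    Walks of length 2 from u to v pass through c u + w with
    beta c = 1 + alpha, so one exists exactly when beta divides 1 + alpha. A walk
    of length 3 through c u + w exists as soon as beta c - alpha divides
    1 + beta, and a finite ring has stable range 1, which lets c be chosen with
    beta c - alpha a unit. So three steps always suffice ([farey_walk3]).

    Whether two steps suffice is therefore a divisibility property of the ring,
    [farey_divisibility]: b divides 1 + a for every unimodular (a, b) other than
    (1, 0). If it fails for (a, b), that vertex is at distance 3 from (1, 0). If
    it holds, then the diameter is at most 2, and it equals 2 as soon as R has an
    element x other than 0 and 1, because there is no edge from (1, 0) to
    (1, x). The only ring without such an x is Z/2Z, where -1 = 1 and any two
    distinct vertices are joined by an edge.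

    It remains to find the rings with this property
    ([farey_divisibility_classification]). Taking b = 0 shows that the only units
    are 1 and -1; taking a = 1 shows that every nonzero element divides 2. A
    power e of any b is idempotent, and both b e + (1 - e) and 1 + b (1 - e)
    are units. If 2 = 0, both units equal 1, which gives b = e; so R is Boolean,
    hence a power of Z/2Z. If 2 is not 0, then e is 0 or 1, since
    otherwise e and 1 - e both divide 2 and thus kill it; so b or 1 + b is
    a unit, R is {0, 1, -1, -2}, and it is Z/3Z or Z/4Z. *)

(** * Distances and diameter in a finite directed graph *)

Section FiniteDirectedGraph.
Variables (T : finType) (e : rel T).

Lemma has_dpathP (k : nat) (u v : T) :
  reflect (has_dpath e k u v)
          [exists p : k.-tuple T, path e u p && (last u p == v)].
Proof.
apply: (iffP existsP) => [[p /andP[up /eqP vp]]|[p [up vp /eqP sp]]].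
  by exists p; rewrite size_tuple.
by exists (Tuple sp); rewrite up vp eqxx.
Qed.

(** Minimal walk lengths exist because, on a finite graph, having a walk of
    a given length is decidable; bounds on walks are then all that is needed. *)
Lemma is_diam_intro (d : nat) :
    (forall u v, exists2 k, has_dpath e k u v & k <= d) ->
    (exists u v, forall k, has_dpath e k u v -> d <= k) ->
  is_diam e d.
Proof.
move=> le_d [u0 [v0 ge_d]]; split=> [u v|]; last first.
  exists u0, v0; split=> //.
  have [k uvk lekd] := le_d u0 v0.
  by rewrite (_ : d = k) //; apply/eqP; rewrite eqn_leq lekd ge_d.
have [k uvk lekd] := le_d u v.
have exP : exists j, [exists p : j.-tuple T, path e u p && (last u p == v)].
  by exists k; apply/has_dpathP.
case: (ex_minnP exP) => m /has_dpathP uvm m_min; exists m.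
  by split=> // j /has_dpathP; apply: m_min.
by apply: leq_trans lekd; apply/m_min/has_dpathP.
Qed.

End FiniteDirectedGraph.

(** * Ring isomorphisms and residue class rings *)

Section Isomorphisms.
Local Open Scope ring_scope.

Lemma ring_isomorphic_intro (R S : pzRingType) (f : R -> S) :
  zmod_morphism f -> monoid_morphism f -> bijective f -> ring_isomorphic R S.
Proof.
move=> fB fM fbij.
pose fZ := GRing.isZmodMorphism.Build R S f fB.
pose fR := GRing.isMonoidMorphism.Build R S f fM.
pose g : {rmorphism R -> S} := HB.pack f fZ fR.
by exists g.
Qed.

Lemma ring_isomorphic_sym (R S : pzRingType) :
  ring_isomorphic R S -> ring_isomorphic S R.
Proof.
case=> f [g fK gK]; apply: (ring_isomorphic_intro (f := g)).
- exact: can2_zmod_morphism fK gK.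
- exact: can2_monoid_morphism fK gK.
- by exists f.
Qed.

(** The additive order of 1 is m, so the map from 'Z_m sending the residue k
    to k%:R is an injective morphism; it is onto because 1 generates R. *)
Lemma ring_isomorphic_Zm (R : finComNzRingType) (m : nat) :
    (1 < m)%N -> m%:R = 0 :> R -> (forall k, (0 < k < m)%N -> k%:R != 0 :> R) ->
    (forall x : R, exists k : nat, x = k%:R) ->
  ring_isomorphic R 'Z_m.
Proof.
move=> m_gt1 m0 m_min gen1; apply: ring_isomorphic_sym.
have natr_mod k : (k %% m)%:R = k%:R :> R.
  by rewrite [in RHS](divn_eq k m) natrD natrM m0 mulr0 add0r.
pose f (z : 'Z_m) : R := (z : nat)%:R.
have fn k : f k%:R = k%:R by rewrite /f val_Zp_nat.
have fB : zmod_morphism f.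
  move=> x y; apply/eqP; rewrite eq_sym subr_eq; apply/eqP.
  rewrite -[x in LHS](subrK y) -(natr_Zp (x - y)) -(natr_Zp y).
  by rewrite -natrD !fn natrD.
have fM : monoid_morphism f.
  split=> [|x y]; first by rewrite -[1]/(1%:R) fn.
  by rewrite -(natr_Zp x) -(natr_Zp y) -natrM !fn natrM.
have finj : injective f.
  move=> x y fxy; apply/eqP; rewrite -subr_eq0; move: (fB x y).
  rewrite fxy subrr; set z := x - y => fz.
  have z_lt : (z < m)%N by rewrite -[X in (_ < X)%N](Zp_cast m_gt1).
  have [/eqP z0|z_gt0] := posnP z; first exact: z0.
  by have := m_min z; rewrite z_gt0 z_lt -/(f z) fz eqxx => /(_ isT).
apply: (ring_isomorphic_intro (f := f)) => //.
apply: inj_card_bij => //.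
rewrite -(card_codom finj); apply/subset_leq_card/subsetP => x _.
by have [k ->] := gen1 x; rewrite -fn codom_f.
Qed.

End Isomorphisms.

(** * Units and idempotents of a finite ring *)

Section FiniteRing.
Local Open Scope ring_scope.
Variable R : finComNzRingType.
Implicit Types a b c e x y z : R.

(** The powers of a are eventually periodic, by the pigeonhole principle; an
    exponent that is past the preperiod and a multiple of the period works. *)
Lemma exists_idempotent_power a :
  exists2 n, (0 < n)%N & a ^+ n * a ^+ n = a ^+ n.
Proof.
pose f (i : 'I_(#|R|.+1)) : R := a ^+ i.
have /injectivePn[i0 [j0 ne_ij fij]] : ~~ injectiveb f.
  by apply/negP => /injectiveP/leq_card; rewrite card_ord ltnn.
wlog lt_ij : i0 j0 ne_ij fij / (i0 < j0)%N => [IH|].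
  have [|lt_ji|eq_ij] := ltngtP i0 j0; first exact: IH.
    by apply: (IH j0 i0); rewrite // eq_sym.
  by move: ne_ij; rewrite (val_inj eq_ij) eqxx.
move: i0 j0 fij lt_ij {ne_ij} => i j; rewrite /f => {f} fij lt_ij.
pose k := (j - i)%N.
have per m : (i <= m)%N -> a ^+ (m + k) = a ^+ m.
  move=> lim; rewrite -(subnK lim) -addnA subnKC; last exact: ltnW.
  by rewrite !exprD -fij.
have perM m q : (i <= m)%N -> a ^+ (m + q * k) = a ^+ m.
  move=> lim; elim: q => [|q IH]; first by rewrite mul0n addn0.
  by rewrite mulSn addnCA addnC per ?IH // (leq_trans lim) ?leq_addr.
have k_gt0 : (0 < k)%N by rewrite subn_gt0.
exists (i.+1 * k)%N; first by rewrite muln_gt0.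
rewrite -exprD perM // (leq_trans (leqnSn i)) //.
by rewrite leq_pmulr.
Qed.

(** Multiplication by t is an injective map from a finite set to itself. *)
Lemma unit_of_regular t :
  (forall z, t * z = 0 -> z = 0) -> exists s, t * s = 1.
Proof.
move=> t_reg.
have t_inj : injective ( *%R t).
  by move=> x y /eqP; rewrite -subr_eq0 -mulrBr => /eqP/t_reg/subr0_eq.
by have [s _ sK] := injF_bij t_inj; exists (s 1); apply: sK.
Qed.

Lemma fixed_by_power t z n : z = t * z -> z = t ^+ n * z.
Proof.
by move=> tz; elim: n => [|n IH]; rewrite ?mul1r // exprSr -mulrA -tz -IH.
Qed.

(** Let e be an idempotent power of a, so that a is invertible on the factor e R
    and nilpotent on (1 - e) R. With c = (1 - e) y nothing changes on the first
    factor, while on the second one a + y b = 1 + a (1 - x) is unipotent. *)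
Lemma stable_range1 a b x y :
  a * x + b * y = 1 -> exists c, exists s, (a + c * b) * s = 1.
Proof.
move=> abxy; have [n n_gt0] := exists_idempotent_power a.
set e := a ^+ n => ee.
have eE : e = a ^+ n.-1 * a by rewrite -exprSr prednK.
exists ((1 - e) * y); apply: unit_of_regular => z tz.
have ez : e * z = 0.
  have aez : a * e * z = 0.
    have : e * ((a + (1 - e) * y * b) * z) = a * e * z + (e - e * e) * (y * b * z).
      by ring.
    by rewrite tz mulr0 ee subrr mul0r addr0.
  by rewrite -ee {1}eE -[X in X * z]mulrA -mulrA aez mulr0.
have zE : z = a * (x - 1) * z.
  transitivity ((a * x + b * y) * z); first by rewrite abxy mul1r.
  transitivity (a * (x - 1) * z + (a + (1 - e) * y * b) * z + y * b * (e * z)).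
    by ring.
  by rewrite tz ez mulr0 !addr0.
by rewrite (fixed_by_power n zE) exprMn -/e mulrAC ez mul0r.
Qed.

(** With e an idempotent power of b, the element b is invertible on e R and
    nilpotent on (1 - e) R. The first unit is b on e R and 1 on the other
    factor; the second is 1 on e R and 1 + b on the other factor. *)
Lemma idempotent_splitting b : exists e,
  [/\ e * e = e,
      exists s, (b * e + (1 - e)) * s = 1
    & exists s, (1 + b * (1 - e)) * s = 1].
Proof.
have [n n_gt0] := exists_idempotent_power b.
set e := b ^+ n => ee; exists e.
have eE : e = b ^+ n.-1 * b by rewrite -exprSr prednK.
split=> //.
- apply: unit_of_regular => z tz.
  have ez : z = e * z.
    have : (1 - e) * ((b * e + (1 - e)) * z) =
             z - e * z + (e - e * e) * (b * z) + (e * e - e) * z by ring.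
    by rewrite tz mulr0 ee subrr !mul0r !addr0 => /esym/subr0_eq.
  have bez : b * (e * z) = 0.
    rewrite -tz [RHS](_ : _ = b * (e * z) + (z - e * z)); last by ring.
    by rewrite -ez subrr addr0.
  by rewrite ez -ee {1}eE -!mulrA bez mulr0.
- apply: unit_of_regular => z tz.
  have ez : e * z = 0.
    have : e * ((1 + b * (1 - e)) * z) = e * z + (e - e * e) * (b * z) by ring.
    by rewrite tz mulr0 ee subrr mul0r addr0.
  have zE : z = - b * z.
    transitivity (- b * z + (1 + b * (1 - e)) * z + b * (e * z)); first by ring.
    by rewrite tz ez mulr0 !addr0.
  by rewrite (fixed_by_power n zE) exprNn -mulrA -/e ez mulr0.
Qed.

End FiniteRing.

(** * Walks in the Farey graph and divisibility *)

Section FareyWalks.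
Local Open Scope ring_scope.
Variable R : finComNzRingType.
Implicit Types (a b c x y : R) (p q w : R * R) (u v : farey_vertex R).

Definition det p q : R := p.1 * q.2 - p.2 * q.1.

Lemma unimodularP p :
  reflect (exists x y, p.1 * x + p.2 * y = 1) (unimodular p).
Proof.
apply: (iffP forallP) => [/(_ 1)/existsP[x /existsP[y /eqP xy]]|[x [y xy]] r].
  by exists x, y.
apply/existsP; exists (x * r); apply/existsP; exists (y * r).
by rewrite !mulrA -mulrDl xy mul1r.
Qed.

Lemma unimodular_det p q : det p q = 1 -> unimodular q.
Proof.
by move=> pq; apply/unimodularP; exists (- p.2), p.1; rewrite -pq /det; ring.
Qed.

Lemma walk2 u v w :
  det (val u) w = 1 -> det w (val v) = 1 -> has_dpath (@farey_edge R) 2 u v.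
Proof.
move=> uw wv; exists [:: Sub w (unimodular_det uw); v]; split=> //=.
by rewrite /farey_edge !SubK -!/(det _ _) uw wv eqxx.
Qed.

Lemma walk3 u v w w' :
    det (val u) w = 1 -> det w w' = 1 -> det w' (val v) = 1 ->
  has_dpath (@farey_edge R) 3 u v.
Proof.
move=> uw ww' w'v.
exists [:: Sub w (unimodular_det uw); Sub w' (unimodular_det ww'); v].
by split=> //=; rewrite /farey_edge !SubK -!/(det _ _) uw ww' w'v eqxx.
Qed.

Lemma exists_det1 u : exists w, det (val u) w = 1.
Proof.
have /unimodularP[x [y xy]] := valP u; exists (- y, x).
by rewrite /det -xy /=; ring.
Qed.

(** Cramer's rule in the basis p, w. *)
Lemma comb_coords p w q : det p w = 1 ->
  (q.1 = det q w * p.1 + det p q * w.1) /\ (q.2 = det q w * p.2 + det p q * w.2).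
Proof.
rewrite /det => pw; split.
  by rewrite -[LHS]mul1r -pw; ring.
by rewrite -[LHS]mul1r -pw; ring.
Qed.

Lemma unimodular_coords p w q :
  det p w = 1 -> unimodular q -> unimodular (det q w, det p q).
Proof.
move=> pw /unimodularP[x [y xy]]; apply/unimodularP.
exists (p.1 * x + p.2 * y), (w.1 * x + w.2 * y).
have [q1 q2] := comb_coords q pw.
by rewrite -[RHS]xy [in RHS]q1 [in RHS]q2 /=; ring.
Qed.

(** The walk is u -> c u + w -> x' u + y' w -> v. Its middle edge forces
    x' = c y' - 1, and the last one then reads
    y' (c beta - alpha) = 1 + beta, solvable when c beta - alpha is a unit. *)
Lemma farey_walk3 u v : has_dpath (@farey_edge R) 3 u v.
Proof.
have [w uw] := exists_det1 u.
have /unimodularP[x [y /= xy]] := unimodular_coords uw (valP v).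
set alpha := det (val v) w in xy; set beta := det (val u) (val v) in xy.
have [c [s cs]] : exists c, exists s, (- alpha + c * beta) * s = 1.
  by apply: (@stable_range1 _ _ _ (- x) y); rewrite mulrNN.
pose y' := s * (1 + beta); pose x' := c * y' - 1.
apply: (@walk3 u v (c * (val u).1 + w.1, c * (val u).2 + w.2)
                   (x' * (val u).1 + y' * w.1, x' * (val u).2 + y' * w.2)).
- by rewrite -uw /det /=; ring.
- transitivity ((c * y' - x') * det (val u) w); first by rewrite /det /=; ring.
  by rewrite uw /x'; ring.
- transitivity (x' * beta - y' * alpha).
    by rewrite /alpha /beta /det /=; ring.
  transitivity ((- alpha + c * beta) * s * (1 + beta) - beta).
    by rewrite /x' /y'; ring.
  by rewrite cs; ring.
Qed.

(** The exact condition for a vertex (a, b), distinct from (1, 0), to be the end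
    of a walk of length 2 from (1, 0). *)
Definition farey_divisibility : bool :=
  [forall a : R, forall b : R, unimodular (a, b) ==>
     ((a, b) == (1, 0)) || [exists c : R, b * c == 1 + a]].

Lemma farey_divisibilityP :
  reflect (forall a b, (exists x y, a * x + b * y = 1) ->
             (a, b) = (1, 0) \/ exists c, b * c = 1 + a)
          farey_divisibility.
Proof.
apply: (iffP forallP) => [H a b ab | H a].
  have /forallP/(_ b)/implyP := H a.
  have abU : unimodular (a, b) by apply/unimodularP.
  move=> /(_ abU)/orP[/eqP|/existsP[c /eqP]]; first by left.
  by right; exists c.
apply/forallP=> b; apply/implyP=> /unimodularP ab; apply/orP.
by case: (H a b ab) => [/eqP|[c /eqP bc]]; [left|right; apply/existsP; exists c].
Qed.

(** In the coordinates given by u and a neighbour w of u, the pair (1, 0) is u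
    itself, so the divisibility hypothesis applies to v. *)
Lemma farey_walk2 u v :
  farey_divisibility -> u != v -> has_dpath (@farey_edge R) 2 u v.
Proof.
move=> /farey_divisibilityP Rdiv neq_uv; have [w uw] := exists_det1 u.
have /unimodularP/Rdiv := unimodular_coords uw (valP v).
have [q1 q2] := comb_coords (val v) uw.
case=> [[va ub]|[c vc]].
  case/eqP: neq_uv; apply: val_inj; move: q1 q2; rewrite va ub.
  rewrite !mul1r !mul0r !addr0.
  by move: (val u) (val v) => [? ?] [? ?] /= -> ->.
apply: (@walk2 u v (c * (val u).1 + w.1, c * (val u).2 + w.2)).
  by rewrite -uw /det /=; ring.
transitivity (det (val u) (val v) * c - det (val v) w).
  by rewrite /det /=; ring.
by rewrite vc addrK.
Qed.

Lemma unimodular_base : unimodular (1 : R, 0 : R).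
Proof. by apply/unimodularP; exists 1, 0; rewrite /= mul0r mulr1 addr0. Qed.

Definition base_vertex : farey_vertex R := Sub (1, 0) unimodular_base.

Lemma base_walk0 v : has_dpath (@farey_edge R) 0 base_vertex v -> val v = (1, 0).
Proof. by case=> p [_ <- /size0nil ->]. Qed.

Lemma base_walk1 v : has_dpath (@farey_edge R) 1 base_vertex v -> (val v).2 = 1.
Proof.
case=> -[|v' [|? ?]] [] //= /andP[+ _] <- _.
by rewrite /farey_edge /= mul1r mul0r subr0 => /eqP.
Qed.

Lemma base_walk2 v :
  has_dpath (@farey_edge R) 2 base_vertex v ->
  exists c, (val v).2 * c = 1 + (val v).1.
Proof.
case=> -[|w [|v' [|? ?]]] [] //= /and3P[+ + _] <- _.
rewrite /farey_edge /= mul1r mul0r subr0 => /eqP-> /eqP wv.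
by exists (val w).1; rewrite -wv; ring.
Qed.

Lemma diam_farey3 : ~~ farey_divisibility -> is_diam (@farey_edge R) 3.
Proof.
move=> Ndiv; apply: is_diam_intro => [u v|].
  by exists 3; first exact: farey_walk3.
have /forallPn[a /forallPn[b]] := Ndiv.
rewrite negb_imply negb_or => /and3P[abU ab_base Nab].
have {}Nab c : b * c <> 1 + a.
  by move=> bc; case/existsP: Nab; exists c; apply/eqP.
exists base_vertex, (Sub (a, b) abU) => -[|[|[|//]]].
- by move/base_walk0; rewrite SubK => /eqP; rewrite (negPf ab_base).
- by move/base_walk1; rewrite SubK => /= b1; case: (Nab (1 + a)); rewrite b1 mul1r.
- by move/base_walk2; rewrite SubK => -[c /Nab].
Qed.

Lemma diam_farey2 x :
    farey_divisibility -> x != 0 -> x != 1 ->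
  is_diam (@farey_edge R) 2.
Proof.
move=> Rdiv x0 x1; apply: is_diam_intro => [u v|].
  have [->|neq_uv] := eqVneq u v; first by exists 0%N => //; exists [::].
  by exists 2; first exact: farey_walk2.
have xU : unimodular (1, x) by apply/unimodularP; exists 1, 0; rewrite /=; ring.
exists base_vertex, (Sub (1, x) xU) => -[|[|//]].
- by move/base_walk0; rewrite SubK => -[/eqP]; rewrite (negPf x0).
- by move/base_walk1; rewrite SubK => /= /eqP; rewrite (negPf x1).
Qed.

Lemma diam_farey1 :
  (forall x, x = 0 \/ x = 1) -> is_diam (@farey_edge R) 1.
Proof.
move=> R01; have oppr1 : -1 = 1 :> R.
  by have [/eqP|//] := R01 (-1); rewrite oppr_eq0 oner_eq0.
have N00 : ~ unimodular (0 : R, 0 : R).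
  case/unimodularP=> x [y /eqP]; rewrite /= !mul0r addr0 eq_sym.
  by rewrite oner_eq0.
apply: is_diam_intro => [u v|].
  have [->|neq_uv] := eqVneq u v; first by exists 0%N => //; exists [::].
  exists 1%N => //; exists [:: v]; split=> //=; rewrite andbT.
  (* The determinant of distinct vectors over {0, 1} is 1 or -1 unless one of
     them is the zero vector, which N00 rules out. *)
  case: u v neq_uv => [[a b] abU] [[c d] cdU]; rewrite -val_eqE /farey_edge /=.
  case: (R01 a) (R01 b) (R01 c) (R01 d) abU cdU => -> [] -> [] -> [] -> // abU cdU;
    by rewrite ?eqxx // ?(mul0r, mulr0, mul1r, subr0, sub0r) ?oppr1 ?eqxx //.
have U01 : unimodular (0 : R, 1 : R).
  by apply/unimodularP; exists 0, 1; rewrite /=; ring.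
exists base_vertex, (Sub (0, 1) U01) => -[|//] /base_walk0; rewrite SubK.
by case=> /esym/eqP; rewrite oner_eq0.
Qed.

End FareyWalks.

(** * Rings with the divisibility property *)

Section Examples.
Local Open Scope ring_scope.

Lemma farey_divisibility_iso (R S : finComNzRingType) :
  ring_isomorphic R S -> farey_divisibility S -> farey_divisibility R.
Proof.
case=> f [g fK gK] /farey_divisibilityP Sdiv.
apply/farey_divisibilityP => a b [x [y xy]].
have finj : injective f := can_inj fK.
have: exists x y, f a * x + f b * y = 1.
  by exists (f x), (f y); rewrite -!rmorphM -rmorphD xy rmorph1.
case/Sdiv=> [[fa fb]|[c fbc]]; [left|right].
  by congr pair; apply: finj; rewrite ?rmorph1 ?rmorph0.
by exists (g c); apply: finj; rewrite rmorphM gK fbc rmorphD rmorph1.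
Qed.

(** Stated as a disjunction over all possible quotients c, the property becomes
    a boolean that evaluates to true for each of the finitely many a, b, x, y. *)
Lemma farey_divisibility_Z3 : farey_divisibility 'Z_3.
Proof.
apply/farey_divisibilityP => a b [x [y /eqP]].
suff: [|| ((a, b) == (1, 0)), b * 0 == 1 + a, b * 1 == 1 + a, b * -1 == 1 + a
        | a * x + b * y != 1].
  case/or4P=> [/eqP|/eqP|/eqP|/orP[/eqP|/negPf->//]]; first by left.
  - by right; exists 0.
  - by right; exists 1.
  - by right; exists (- 1).
by case: a b x y => [[|[|[|//]]] ?] [[|[|[|//]]] ?] [[|[|[|//]]] ?] [[|[|[|//]]] ?].
Qed.

Lemma farey_divisibility_Z4 : farey_divisibility 'Z_4.
Proof.
apply/farey_divisibilityP => a b [x [y /eqP]].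
suff: [|| ((a, b) == (1, 0)), [|| b * 0 == 1 + a, b * 1 == 1 + a,
           b * 2%:R == 1 + a | b * -1 == 1 + a] | a * x + b * y != 1].
  case/or3P=> [/eqP|/or4P[]/eqP|/negPf->//]; first by left.
  - by right; exists 0.
  - by right; exists 1.
  - by right; exists 2%:R.
  - by right; exists (- 1).
by case: a b x y => [[|[|[|[|//]]]] ?] [[|[|[|[|//]]]] ?] [[|[|[|[|//]]]] ?]
                    [[|[|[|[|//]]]] ?].
Qed.

Lemma card_gt2P (R : finComNzRingType) :
  reflect (exists2 x : R, x != 0 & x != 1) (2 < #|R|)%N.
Proof.
rewrite -(cardC (pred2 (0 : R) 1)) card2 eq_sym oner_eq0 -[X in (X < _)%N]addn0.
rewrite ltn_add2l; apply: (iffP card_gt0P) => [[x]|[x x0 x1]]; last first.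
  by exists x; rewrite !inE negb_or x0.
by rewrite !inE => /norP[x0 x1]; exists x.
Qed.

End Examples.

(** * Boolean rings *)

Section BooleanRing.
Local Open Scope ring_scope.
Variable R : finComNzRingType.
Hypothesis boolR : forall x : R, x * x = x.
Implicit Types a b d x y : R.

Lemma boolean_opp x : - x = x.
Proof. by rewrite -[LHS]boolR mulrNN boolR. Qed.

(** If a x + b y = 1 then (1 - a) (1 - b) kills both a and b, hence 1;
    and 1 - a = 1 + a, so 1 + a = b (1 + a). *)
Lemma boolean_farey_divisibility : farey_divisibility R.
Proof.
apply/farey_divisibilityP => a b [x [y xy]]; right; exists (1 + a).
apply/esym/subr0_eq.
(* The difference is (1 - b) (1 + a), multiplied here by a x + b y = 1. *)
transitivity ((1 - b) * (1 + a) * (a * x + b * y)).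
  by rewrite xy; ring.
transitivity ((1 - b) * x * (a * a + a) + (1 + a) * y * (b - b * b)).
  by ring.
by rewrite !boolR -{2}[a]boolean_opp !subrr !mulr0 addr0.
Qed.

(** In the order of a Boolean ring the elements below a are the products x a,
    so these are the minimal nonzero elements. *)
Definition atom a : bool :=
  (a != 0) && [forall x : R, (x * a == 0) || (x * a == a)].

(** Among the nonzero elements a below d, take one generating a smallest ideal:
    a nonzero x a generates the same ideal, so a is a multiple of x a. *)
Lemma exists_atom d : d != 0 -> exists2 a, atom a & d * a = a.
Proof.
move=> d0; pose P a := (a != 0) && (d * a == a).
pose M a := #|[set x * a | x in R]|.
have Pd : P d by rewrite /P d0 boolR eqxx.
case: (arg_minnP M Pd) => a /andP[a0 /eqP da] a_min; exists a => //.
rewrite /atom a0; apply/forallP => x; rewrite -implyNb; apply/implyP => xa0.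
have Pxa : P (x * a) by rewrite /P xa0 mulrCA da eqxx.
have sub : [set y * (x * a) | y in R] \subset [set y * a | y in R].
  by apply/subsetP => _ /imsetP[y _ ->]; rewrite mulrA; apply: imset_f.
have/eqP E : [set y * (x * a) | y in R] == [set y * a | y in R].
  by rewrite eqEcard sub; apply: a_min.
have : a \in [set y * (x * a) | y in R].
  by rewrite E; apply/imsetP; exists 1; rewrite // mul1r.
case/imsetP=> y _ ay; apply/eqP.
by rewrite [in LHS]ay mulrCA [x * (x * a)]mulrA boolR -ay.
Qed.

Let A := [set a | atom a].
Let at_ (i : 'I_#|A|) : R := enum_val i.
(** Every atom a is a point of the spectrum of R: x a is 0 or a, and this is the
    value of x at that point. *)
Let coords x : {ffun 'I_#|A| -> 'Z_2} := [ffun i => (x * at_ i == at_ i)%:R].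

Lemma atomP i x :
  (x * at_ i = 0 /\ coords x i = 0) \/ (x * at_ i = at_ i /\ coords x i = 1).
Proof.
have : atom (at_ i) by have := enum_valP i; rewrite inE.
case/andP=> a0 /forallP/(_ x)/orP[] /eqP xa; [left|right]; rewrite ffunE xa.
  by rewrite eq_sym (negPf a0).
by rewrite eqxx.
Qed.

Lemma at_neq0 i : at_ i != 0.
Proof. by have := enum_valP i; rewrite inE => /andP[]. Qed.

Lemma coords_eq i x (z : 'Z_2) : x * at_ i = z%:R * at_ i -> coords x i = z.
Proof.
move=> xa; rewrite ffunE xa -[RHS]natr_Zp.
case: z {xa} => [[|[|//]] ?] /=; last by rewrite mul1r eqxx.
by rewrite mul0r eq_sym (negPf (at_neq0 i)).
Qed.

Lemma atom_orthogonal i j : i != j -> at_ i * at_ j = 0.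
Proof.
move=> neq_ij; have [[]//|[ij _]] := atomP j (at_ i).
have [[ji _]|[ji _]] := atomP i (at_ j); first by rewrite mulrC.
by case/eqP: neq_ij; apply: enum_val_inj; rewrite -/(at_ i) -/(at_ j) -ij mulrC ji.
Qed.

(** The inverse sends a family of coordinates to the sum of the atoms where it is
    1. Injectivity holds because an atom lies below any nonzero x - y. *)
Lemma coords_bij : bijective coords.
Proof.
pose g (z : {ffun 'I_#|A| -> 'Z_2}) : R := \sum_i (z i)%:R * at_ i.
have gK : cancel g coords.
  move=> z; apply/ffunP => j; apply: coords_eq.
  rewrite /g mulr_suml (bigD1 j) //= -mulrA boolR big1 ?addr0 // => i neq_ij.
  by rewrite -mulrA atom_orthogonal ?mulr0.
exists g => //; apply: inj_can_sym gK _ => x y xy.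
apply/eqP; rewrite -subr_eq0; apply/negPn/negP => /exists_atom[a a_atom].
have aA : a \in A by rewrite inE.
have <- : at_ (enum_rank_in aA a) = a by rewrite /at_ enum_rankK_in.
set i := enum_rank_in aA a; rewrite mulrBl.
have := at_neq0 i; have /ffunP/(_ i) := xy.
case: (atomP i x) (atomP i y) => -[-> ->] [] [-> ->] // _ a0;
  by move/eqP; rewrite subrr eq_sym (negPf a0).
Qed.

Lemma coords_zmod_morphism : zmod_morphism coords.
Proof.
move=> x y; apply/ffunP => i; rewrite [RHS]ffunE [(- coords y) i]ffunE.
apply: coords_eq; rewrite mulrBl.
case: (atomP i x) (atomP i y) => -[-> ->] [] [-> ->] /=;
  by rewrite ?(mul0r, mul1r, subrr, subr0) // sub0r boolean_opp.
Qed.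

Lemma coords_monoid_morphism : monoid_morphism coords.
Proof.
split=> [|x y]; apply/ffunP => i; apply: coords_eq.
  by rewrite ffunE.
rewrite ffunE -mulrA.
case: (atomP i x) (atomP i y) => -[xi ->] [] [-> ->] /=;
  by rewrite ?(mulr0, mul0r, mul1r).
Qed.

Lemma boolean_ring_isomorphic :
  exists n : nat, ring_isomorphic R {ffun 'I_n -> 'Z_2}.
Proof.
exists #|A|; apply: ring_isomorphic_intro coords_bij.
- exact: coords_zmod_morphism.
- exact: coords_monoid_morphism.
Qed.

End BooleanRing.

(** * Classification of the rings with the divisibility property *)

Section Classification.
Local Open Scope ring_scope.
Variable R : finComNzRingType.
Implicit Types a b x y : R.

Lemma ring_isomorphic_Z2 : (forall x, x = 0 \/ x = 1) -> ring_isomorphic R 'Z_2.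
Proof.
move=> R01; apply: ring_isomorphic_Zm => //.
- case: (R01 2%:R) => // /eqP.
  by rewrite -subr_eq0 [_ - _](_ : _ = 1) ?oner_eq0; last ring.
- by case=> [|[|]] // _; apply: oner_neq0.
- by move=> x; case: (R01 x) => ->; [exists 0%N|exists 1%N].
Qed.

Lemma isomorphic_Z2_elements : ring_isomorphic R 'Z_2 -> forall x, x = 0 \/ x = 1.
Proof.
case=> f [g fK gK] x; have finj := can_inj fK.
have: f x = 0 \/ f x = 1.
  by case: (f x) => [[|[|//]]] ?; [left|right]; apply: val_inj.
by case=> fx; [left|right]; apply: finj; rewrite fx ?rmorph0 ?rmorph1.
Qed.

(** All elements are integer multiples of 1. As 2 is one of the four listed
    elements but is neither 0 nor 1, either 3 = 0 or 4 = 0. *)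
Lemma small_ring_isomorphic :
    2%:R != 0 :> R -> (forall x, [\/ x = 0, x = 1, x = -1 | x = - 2%:R]) ->
  ring_isomorphic R 'Z_3 \/ ring_isomorphic R 'Z_4.
Proof.
move=> two_neq0 R4.
have [three0|three_neq0] := eqVneq (3%:R : R) 0.
  left; apply: ring_isomorphic_Zm => //.
    by case=> [|[|[|]]] // _; apply: oner_neq0.
  move=> x; case: (R4 x) => ->; [exists 0%N|exists 1%N|exists 2%N|exists 1%N] => //.
    by apply/eqP; rewrite -subr_eq0 -oppr_eq0 -three0; apply/eqP; ring.
  by apply/eqP; rewrite -subr_eq0 -oppr_eq0 -three0; apply/eqP; ring.
have four0 : 4%:R = 0 :> R.
  case: (R4 2%:R) => /eqP; first by rewrite (negPf two_neq0).
  - by rewrite -subr_eq0 [_ - _](_ : _ = 1) ?oner_eq0; last ring.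
  - by rewrite -subr_eq0 [_ - _](_ : _ = 3%:R) ?(negPf three_neq0); last ring.
  - by rewrite -subr_eq0 => /eqP <-; ring.
right; apply: ring_isomorphic_Zm => //.
  by case=> [|[|[|[|]]]] // _; apply: oner_neq0.
move=> x; case: (R4 x) => ->; [exists 0%N|exists 1%N|exists 3%N|exists 2%N] => //.
  by apply/eqP; rewrite -subr_eq0 -oppr_eq0 -four0; apply/eqP; ring.
by apply/eqP; rewrite -subr_eq0 -oppr_eq0 -four0; apply/eqP; ring.
Qed.

Section Divisibility.
Hypothesis Rdiv : farey_divisibility R.

Lemma farey_units a s : a * s = 1 -> a = 1 \/ a = -1.
Proof.
move=> as1; have a0U : exists x y, a * x + 0 * y = 1.
  by exists s, 0; rewrite as1 mul0r addr0.
have /farey_divisibilityP/(_ a 0 a0U)[[->]|[c]] := Rdiv; first by left.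
by rewrite mul0r => /esym/addr0_eq <-; right.
Qed.

Lemma farey_divides2 b : b != 0 -> exists c, b * c = 2%:R.
Proof.
move=> b0; have b1U : exists x y, 1 * x + b * y = 1.
  by exists 1, 0; rewrite mulr0 addr0 mulr1.
have /farey_divisibilityP/(_ 1 b b1U)[[/eqP]|//] := Rdiv.
by rewrite (negPf b0).
Qed.

(** As 1 is the only unit, idempotent_splitting gives b (1 - e) = 0 and
    b e = e, so b is the idempotent e. *)
Lemma farey_boolean : 2%:R = 0 :> R -> forall b, b * b = b.
Proof.
move=> two0 b.
have units a s : a * s = 1 -> a = 1.
  case/farey_units=> // ->; apply/eqP; rewrite eq_sym -subr_eq0 -two0.
  by apply/eqP; ring.
have [e [ee [s /units u1] [t /units u2]]] := idempotent_splitting b.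
have be0 : b * (1 - e) = 0.
  by apply: (addrI 1); rewrite u2 addr0.
have be : b * e = b by apply/esym/subr0_eq; rewrite -[RHS]be0; ring.
move: u1; rewrite be => u1.
have eb : b = e.
  by apply: (addIr (1 - e)); rewrite u1; ring.
by rewrite eb.
Qed.

(** An idempotent e other than 0 and 1 would make both e and 1 - e divide 2;
    then 2 = 2 e + 2 (1 - e) = 0. So e is 0 or 1, and 1 + b or b is a unit,
    hence 1 or -1. *)
Lemma farey_small : 2%:R != 0 :> R ->
  forall x, [\/ x = 0, x = 1, x = -1 | x = - 2%:R].
Proof.
move=> two0 b.
have [e [ee [s u1] [t u2]]] := idempotent_splitting b.
have [e0|e_neq0] := eqVneq e 0.
  move: u2; rewrite e0 subr0 mulr1 => /farey_units[] u.
    by constructor 1; apply: (addrI 1); rewrite u addr0.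
  by constructor 4; apply: (addrI 1); rewrite u; ring.
have [e1|/eqP e_neq1] := eqVneq (1 - e) 0.
  move: u1; rewrite e1 addr0 -(subr0_eq e1) mulr1.
  by case/farey_units => ->; [constructor 2|constructor 3].
have [c ec] := farey_divides2 e_neq0.
have [d ed] : exists d, (1 - e) * d = 2%:R by apply/farey_divides2/eqP.
case/eqP: two0.
transitivity (e * 2%:R + (1 - e) * 2%:R); first by ring.
rewrite -{1}ed -ec.
transitivity ((e - e * e) * (d + c)); first by ring.
by rewrite ee subrr mul0r.
Qed.

End Divisibility.

Lemma farey_divisibility_classification :
    farey_divisibility R ->
  [\/ ring_isomorphic R 'Z_3, ring_isomorphic R 'Z_4
    | exists n : nat, ring_isomorphic R {ffun 'I_n -> 'Z_2}].
Proof.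
move=> Rdiv; have [two0|two_neq0] := eqVneq (2%:R : R) 0.
  by constructor 3; apply/boolean_ring_isomorphic/farey_boolean.
have [] := small_ring_isomorphic two_neq0 (farey_small Rdiv two_neq0).
  by constructor 1.
by constructor 2.
Qed.

End Classification.

Theorem theorem4p1 (R : finComNzRingType) :
  let is_Z2 := ring_isomorphic R 'Z_2 in
  let is_Z3_Z4_or_Z2n :=
    [\/ ring_isomorphic R 'Z_3, ring_isomorphic R 'Z_4
      | exists2 n : nat, 1 < n & ring_isomorphic R {ffun 'I_n -> 'Z_2}] in
  [/\ is_Z2 -> is_diam (@farey_edge R) 1,
      is_Z3_Z4_or_Z2n -> is_diam (@farey_edge R) 2
    & ~ is_Z2 -> ~ is_Z3_Z4_or_Z2n -> is_diam (@farey_edge R) 3].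
Proof.
move=> is_Z2 is_Z3_Z4_or_Z2n; split=> [Z2|Zs|NZ2 NZs].
- exact/diam_farey1/isomorphic_Z2_elements.
- have [Rdiv card_gt2] : farey_divisibility R /\ 2 < #|R|.
    case: Zs => [Z3|Z4|[n n_gt1 Z2n]].
    + split; first exact: farey_divisibility_iso Z3 farey_divisibility_Z3.
      by case: Z3 => f /bij_eq_card ->; rewrite card_ord.
    + split; first exact: farey_divisibility_iso Z4 farey_divisibility_Z4.
      by case: Z4 => f /bij_eq_card ->; rewrite card_ord.
    + case: Z2n => f f_bij; split.
        apply: boolean_farey_divisibility => x; have [g fK gK] := f_bij.
        apply: (can_inj fK); rewrite rmorphM; apply/ffunP => i; rewrite ffunE.
        by case: (f x i) => [[|[|//]] ?]; apply: val_inj.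
      rewrite (bij_eq_card f_bij) card_ffun !card_ord.
      by rewrite (@leq_trans (2 ^ 2)) // leq_exp2l.
  have /card_gt2P[x x0 x1] := card_gt2.
  exact: diam_farey2 Rdiv x0 x1.
- apply/diam_farey3/negP => /farey_divisibility_classification Rs; apply: NZs.
  case: Rs => [Z3|Z4|[n Z2n]]; [by constructor 1|by constructor 2|constructor 3].
  exists n => //; rewrite ltnNge; apply/negP => n_le1; apply: NZ2.
  apply: ring_isomorphic_Z2 => x.
  have [->|x0] := eqVneq x 0%R; first by left.
  have [->|x1] := eqVneq x 1%R; first by right.
  (* With n at most 1 the ring has at most two elements. *)
  have : 2 < #|R| by apply/card_gt2P; exists x.
  case: Z2n => f /bij_eq_card ->; rewrite card_ffun !card_ord ltnNge.
  by rewrite -[X in _ <= X](expn1 2) leq_exp2l ?n_le1.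
Qed.
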